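(* Let $\xi\ge\frac1n$. Suppose there exists an $(\epsilon,\delta)$-node DP algorithm $\mathcal M$ such that for any balanced $\theta\in[2]^n$, on input $G\sim SBM(n,2,B,\theta)$, $$\mathbb P(\mathcal L(\mathcal M(G),\theta)\le\xi)\ge1-\eta,$$ where the randomness is over both the algorithm and the stochastic block model. Then $$\epsilon\ge\frac{\log\left(\max\left\{1,\ \frac{\left(1-\eta-4\delta\xi ne^{4\epsilon\xi n}\right)\left(\frac{(4e\xi)^{-\xi n}}{2}-1\right)}{\eta}\right\}\right)}{4\xi n}.$$ In particular, if $\eta=O\left(\frac{1}{\log n}\right)$, $\xi\le\frac{c_0}{n}$, $\delta\asymp\frac{1}{\mathrm{poly}(n)}$, and $\delta e^{4c_0\epsilon}<c_1$, with constants $c_0,c_1>0$, then $\epsilon\succsim\log n$.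
   Context: Asymptotics: parameters may depend on $n$. $f\succsim g$ means $f(n)\ge c\,g(n)$ for all sufficiently large $n$, for a constant $c>0$; $f\asymp g$ means both $f\succsim g$ and $g\succsim f$. $\mathrm{poly}(n)$ denotes a quantity of order $\Theta(n^\alpha)$ for some constant $\alpha>0$. $\mathcal G_n$ is the set of unweighted undirected graphs on $[n]$. $d_{node}(G,G')$ is the minimum number of nodes that must be rewired (row/column of the adjacency matrix changed) to turn $G'$ into $G$; $G\sim_{node}G'$ if $d_{node}(G,G')\le1$. A randomized algorithm $\mathcal M$ on $\mathcal G_n$ (here with values in $[2]^n$) is $(\epsilon,\delta)$-node DP if $\mathbb P(\mathcal M(G)\in S)\le e^\epsilon\mathbb P(\mathcal M(G')\in S)+\delta$ for all $G\sim_{node}G'$ and measurable $S$. $\theta\in[k]^n$ is balanced if $|\{i:\theta_i=j\}|=n/k$ for all $j$. For symmetric invertible $B\in(0,1]^{k\times k}$, $SBM(n,k,B,\theta)$ is the random graph whose adjacency matrix has independent $A_{ij}\sim\mathrm{Ber}(B_{\theta_i,\theta_j})$ for $i<j$, $A_{ji}=A_{ij}$, zero diagonal. $\mathcal L(\hat\theta,\theta)=\min_{\sigma\in S_k}\frac2n\sum_{i=1}^n\mathbf 1\{\sigma(\hat\theta_i)\ne\theta_i\}$, with $S_k$ the permutation group of $[k]$; here $k=2$.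
   Formalization: Added for the bound: the factors 1−η−4δξn·e^{4εξn} and (4eξ)^{−ξn}/2−1 are not both negative (otherwise it fails, e.g. n=2, ξ=δ=1, ε=0, η=1/2) and η>0; throughout ε≥0 and n is even (balanced θ exist only then), so the asymptotic claim is over even n. *)

(* Defs.v *)
From HB Require Import structures.
From mathcomp Require Import all_boot all_order all_fingroup all_algebra.
From mathcomp Require Import all_classical all_reals all_analysis.
Import Order.TTheory GRing.Theory Num.Theory numFieldNormedType.Exports.

Set Implicit Arguments.
Unset Strict Implicit.
Unset Printing Implicit Defensive.

Local Open Scope ring_scope.

(* All random objects below take finitely many values (graphs on [n] and label
   vectors), so laws are probability mass functions and every set of values is
   measurable. *)
Record fdist (R : realType) (T : finType) := FDist {
  pmf :> {ffun T -> R};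
  pmf_ge0 : forall x, 0 <= pmf x;
  pmf_sum1 : \sum_x pmf x = 1 }.

Definition Pr (R : realType) (T : finType) (d : fdist R T) (S : {set T}) : R :=
  \sum_(x in S) d x.

Definition is_graph n (A : 'M[bool]_n) : bool :=
  (A^T == A) && [forall i, ~~ A i i].

Definition graph n := {A : 'M[bool]_n | is_graph A}.

Definition adj n (G : graph n) : 'M[bool]_n := val G.

(* [G'] can be turned into [G] by rewiring only the nodes of [W]: entries of the
   adjacency matrix outside the rows and columns of [W] are unchanged. *)
Definition rewiring n (G G' : graph n) (W : {set 'I_n}) : bool :=
  [forall i, forall j,
     [&& i \notin W & j \notin W] ==> (adj G i j == adj G' i j)].

Definition d_node n (G G' : graph n) : nat :=
  #|[arg min_(W < [set: 'I_n]%SET | rewiring G G' W) #|W| ]|.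

Definition labels n k := {ffun 'I_n -> 'I_k}.

(* A randomized algorithm is given by the law of its output on each input. *)
Definition algorithm (R : realType) n k := graph n -> fdist R (labels n k).

Definition node_dp (R : realType) n k (eps delta : R) (M : algorithm R n k) :=
  forall G G' : graph n, (d_node G G' <= 1)%N ->
  forall S : {set labels n k},
    Pr (M G) S <= expR eps * Pr (M G') S + delta.

(* |{i : theta_i = j}| = n / k, with exact division. *)
Definition balanced n k (theta : labels n k) : Prop :=
  forall j : 'I_k, (k * #|[set i | theta i == j]%SET|)%N = n.

Definition sbm_matrix (R : realType) k (B : 'M[R]_k) : Prop :=
  [/\ B^T = B, B \in unitmx & forall i j, 0 < B i j <= 1].

Definition sbm (R : realType) n k (B : 'M[R]_k) (theta : labels n k)
    (G : graph n) : R :=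
  \prod_(i < n) \prod_(j < n | (i < j)%N)
    bernoulli_pmf (B (theta i) (theta j)) (adj G i j).

Definition misrate (R : realType) n k (est theta : labels n k) (s : 'S_k) : R :=
  2 / n%:R * \sum_(i < n) (s (est i) != theta i)%:R.

(* The minimum over all permutations; its default value is the one at the
   identity permutation. *)
Definition loss (R : realType) n k (est theta : labels n k) : R :=
  \big[Num.min/misrate R est theta 1%g]_(s : 'S_k) misrate R est theta s.

(* P(L(M(G), theta) <= xi) for G ~ SBM(n, k, B, theta), over the randomness of
   both G and M. *)
Definition success (R : realType) n k (M : algorithm R n k) (B : 'M[R]_k)
    (theta : labels n k) (xi : R) : R :=
  \sum_(G : graph n)
    sbm B theta G * Pr (M G) [set est | loss R est theta <= xi]%SET.

(* Some node-DP algorithm recovers every balanced theta in [2]^n up to loss xi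
   with probability at least 1 - eta; B is fixed and may be known to it. *)
Definition dp_recovery (R : realType) n (B : 'M[R]_2) (eps delta xi eta : R) :=
  exists M : algorithm R n 2,
    node_dp eps delta M /\
    forall theta : labels n 2, balanced theta -> 1 - eta <= success M B theta xi.

(* n tends to infinity along even numbers: for odd n, [2]^n has no balanced
   vector. *)
Definition even_oo : set_system nat :=
  within (fun n => ~~ odd n : Prop) \oo%classic.

#[export] Instance even_oo_filter : ProperFilter even_oo.
Proof.
rewrite /even_oo; split; last exact: within_filter.
case=> N _ /(_ N.*2); apply; last by rewrite odd_double.
by rewrite /= -addnn leq_addr.
Qed.

Definition asymp_ge (R : realType) (f g : nat -> R) : Prop :=
  exists2 c : R, 0 < c & \forall n \near even_oo, c * g n <= f n.

Definition asymp_eq (R : realType) (f g : nat -> R) : Prop :=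
  asymp_ge f g /\ asymp_ge g f.

Definition is_poly_order (R : realType) (p : nat -> R) : Prop :=
  exists2 alpha : R, 0 < alpha & asymp_eq p (fun n => n%:R `^ alpha).

Lemma sbm_ge0 (R : realType) n k (B : 'M[R]_k) (theta : labels n k) G :
  sbm_matrix B -> 0 <= sbm B theta G.
Proof.
case=> _ _ B01; apply: prodr_ge0 => i _; apply: prodr_ge0 => j _.
have /andP[B0 B1] := B01 (theta i) (theta j).
by apply: bernoulli_pmf_ge0; rewrite ltW.
Qed.

Lemma d_nodeP n (G G' : graph n) m :
  reflect (exists2 W : {set 'I_n}, rewiring G G' W & (#|W| <= m)%N)
          (d_node G G' <= m)%N.
Proof.
rewrite /d_node; case: arg_minnP => [|W rW minW].
  by apply/forallP=> i; apply/forallP=> j; rewrite !inE.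
by apply: (iffP idP) => [?|[V rV /(leq_trans (minW _ rV))]//]; exists W.
Qed.

Lemma lossP (R : realType) n k (est theta : labels n k) (xi : R) :
  reflect (exists s : 'S_k, misrate R est theta s <= xi)
          (loss R est theta <= xi).
Proof.
apply: (iffP idP) => [|[s les]]; last first.
  by apply: le_trans les; exact: bigmin_le_cond.
rewrite /loss; elim/big_ind: _ => [|x y hx hy|s _]; first by exists 1%g.
  by rewrite ge_min => /orP[/hx|/hy].
by exists s.
Qed.

Lemma sbm_sum1 (R : realType) n k (B : 'M[R]_k) (theta : labels n k) :
  \sum_(G : graph n) sbm B theta G = 1.
Proof.
pose Q (p : 'I_n * 'I_n) := (p.1 < p.2)%N.
pose P := {p | Q p}.
pose F (p : P) b := bernoulli_pmf (B (theta (val p).1) (theta (val p).2)) b.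
have F1 p : \sum_b F p b = 1.
  by rewrite big_bool /F /bernoulli_pmf /= addrC subrK.
pose em (f : {ffun P -> bool}) i j := if insub (i, j) is Some p then f p else false.
pose mx f : 'M[bool]_n := \matrix_(i, j) (em f i j || em f j i).
have mxG f : is_graph (mx f).
  apply/andP; split; first by apply/eqP/matrixP => i j; rewrite !mxE orbC.
  by apply/forallP => i; rewrite mxE /em orbb insubF // /Q /= ltnn.
pose h f : graph n := Sub (mx f) (mxG f).
have emE f (i j : 'I_n) (ij : (i < j)%N) : mx f i j = f (@exist _ Q (i, j) ij).
  rewrite mxE /em (@insubT _ Q P (i, j) ij) insubF ?orbF //.
  by rewrite /Q /= ltnNge ltnW.
have hbij : bijective h.
  exists (fun G : graph n => [ffun p : P => adj G (val p).1 (val p).2]).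
    by move=> f; apply/ffunP => -[[i j] ij]; rewrite ffunE /= emE.
  move=> G; apply/val_inj/matrixP => i j.
  have /andP[/eqP/matrixP sG /forallP dG] := valP G.
  have sGE a b : val G a b = val G b a by rewrite -[LHS]sG mxE.
  case: (ltngtP i j) => ij.
  - by rewrite emE ffunE.
  - by have := emE [ffun p : P => adj G (val p).1 (val p).2] _ _ ij;
      rewrite ffunE /= mxE orbC sGE /= mxE => ->.
  - have -> : i = j by exact: val_inj.
    by rewrite (negbTE (dG j)) mxE /em orbb insubF // /Q /= ltnn.
rewrite (reindex h) /=; last exact: onW_bij.
transitivity (\sum_(f : {ffun P -> bool}) \prod_p F p (f p)).
  apply: eq_bigr => f _; rewrite /sbm pair_big_dep /=.
  rewrite (reindex_omap (val : P -> _) insub) /=; last first.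
    by move=> p pP; rewrite insubT.
  apply: eq_big => [[[i j] ij]|[[i j] ij] _] /=.
    by have := valK (exist _ (i, j) ij : P); rewrite /= => ->;
      rewrite eqxx andbT; have := ij; rewrite /Q.
  by rewrite /F /= emE.
by rewrite -bigA_distr_bigA /= big1.
Qed.

(* Main.v *)
Require Import Defs.
From HB Require Import structures.
From mathcomp Require Import all_boot all_order all_fingroup all_algebra.
From mathcomp Require Import all_classical all_reals all_analysis.
From mathcomp Require Import ring lra zify.
Import boot.fintype boot.finset.
Import Order.TTheory GRing.Theory Num.Theory numFieldNormedType.Exports.

Set Implicit Arguments.
Unset Strict Implicit.
Unset Printing Implicit Defensive.

(** The bound comes from a packing argument.  Write x = xi n.  A loss of at most
xi leaves at most x/2 misclassified nodes up to relabelling, so the sets of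
estimates that are accurate for two labellings are disjoint as soon as these
labellings differ in more than x nodes and agree in more than x nodes
([loss_balls_disjoint]).  Suppose that a balanced labelling has m other balanced
labellings around it, at Hamming distance at most 4 x, all of them separated in
this sense.  Accuracy gives each of the m + 1 disjoint sets probability at least
1 - eta under its own block model.  Privacy carries this over to the central
model: two block models whose labellings differ in d nodes can be coupled so that
the graphs differ in d nodes, which costs a factor exp (d eps) and an additive
error ([output_prob_group]).  Under the central model the set of the centre
already takes 1 - eta, so the other m sets share the mass eta, and
  m (1 - eta - 4 delta x exp (4 eps x)) <= eta exp (4 eps x).

The coupling is done one vertex at a time.  Draw G from one model and H from the
other independently, and exchange their edges at the vertex where the labellings
differ.  This is an involution on pairs of graphs which exchanges the two
labellings in the joint weight ([sbm_splice]), so G with the edges of H at that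
vertex follows the other model, and it is a neighbour of G.

The packing is made of the labellings obtained from a balanced one by flipping a
nodes of each class, a being the integer part of 2 x.  With N = n / 2 there are
'C(N, a)^2 of them.  Let s be the integer part of x / 2.  In a maximal family
where each flip set has more than s elements outside each other one, every flip
set is within s elements of a member ([greedy_packing]); at most
'C(2 a, s) 'C(n, s) of them are that close to a given one ([card_near_set]), so m
is at least the quotient.  As a >= 4 s, this quotient is at least
(N / (e a))^(2 a - s) ([packing_size_ge]), hence at least (4 e xi)^(-x) if
4 e xi < 1; otherwise the bound to prove is not positive.

For the asymptotic statement, either delta exp (4 c0 eps) is bounded below, and
then eps >= (log (1/delta) - O(1)) / (4 c0), which is of order log n because delta
decays polynomially; or it is small, the first factor of the bound is at least
1/2, the second is of order at least n because x >= 1, and the bound reads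
4 c0 eps >= log n - O(1) ([dp_recovery_eps_ge_log]). *)

Local Open Scope ring_scope.

(** * Binomial coefficients and packings of sets *)

(** Factor by factor, (n - i) k >= n (k - i). *)
Lemma expn_le_bin n k : (k <= n)%N -> (n ^ k <= k ^ k * 'C(n, k))%N.
Proof.
move=> kn; rewrite -(leq_pmul2r (fact_gt0 k)) -mulnA bin_ffact -ffactnn.
rewrite !ffact_prod -[X in (_ ^ X)%N]card_ord -[X in (_ <= _ ^ X * _)%N]card_ord.
rewrite -!prod_nat_const -!big_split /=; apply: leq_prod => i _.
have := ltn_ord i; move: (i : nat) => j jk.
by rewrite !mulnBr (mulnC n k) leq_sub2l // leq_mul2r kn orbT.
Qed.

Lemma bin_le_expn n k : ('C(n, k) * k`! <= n ^ k)%N.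
Proof.
rewrite bin_ffact ffact_prod -[X in (_ <= _ ^ X)%N]card_ord -prod_nat_const.
by apply: leq_prod => i _; rewrite leq_subr.
Qed.

Lemma set_between (T : finType) (X Y : {set T}) s :
  X \subset Y -> (#|X| <= s <= #|Y|)%N ->
  exists D : {set T}, [/\ X \subset D, D \subset Y & #|D| = s].
Proof.
move=> XY /andP[Xs sY].
have : (0 < #|[set A : {set T} | (A \subset Y :\: X) && (#|A| == s - #|X|)]|)%N.
  rewrite cards_draws bin_gt0 cardsD (setIidPr XY); exact: leq_sub2r.
case/card_gt0P => A; rewrite inE => /andP[]; rewrite subsetD => /andP[AY dAX] /eqP cA.
exists (X :|: A)%SET; split; first exact: subsetUl.
  by rewrite subUset XY.
rewrite cardsU cA; have /eqP -> : (X :&: A == set0)%SET.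
  by rewrite setI_eq0 disjoint_sym.
by rewrite cards0 subn0 subnKC.
Qed.

(** A set B of the size of A that misses at most s elements of A is obtained from A
by removing s elements, including all those of A outside B, and adding s
elements, some of which may have just been removed.  This over-counts, but gives
a bound by one product of binomials instead of a sum over radii. *)
Lemma card_near_set (T : finType) (A : {set T}) s : (s <= #|A|)%N ->
  (#|[set B : {set T} | (#|B| == #|A|) && (#|A :\: B| <= s)%N]%SET|
     <= 'C(#|A|, s) * 'C(#|T|, s))%N.
Proof.
move=> sA; rewrite -cards_draws -card_draws -cardsX.
apply: leq_trans (leq_imset_card (fun p => (A :\: p.1) :|: p.2)%SET _).
apply/subset_leq_card/subsetP => B; rewrite inE => /andP[/eqP cB AB].
have [||D [ABD DA cD]] := @set_between _ (A :\: B) A s.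
- exact: subsetDl.
- by rewrite AB.
have ADB : A :\: D \subset B.
  apply/subsetP => i; rewrite inE => /andP[iD iA].
  by apply: contraNT iD => iB; apply: (subsetP ABD); rewrite inE iB.
apply/imsetP; exists (D, B :\: (A :\: D))%SET => /=.
  rewrite !inE /= DA cD eqxx /= cardsD (setIidPr ADB) cB cardsD (setIidPr DA) cD.
  by rewrite subKn.
apply/setP => i; rewrite !inE.
have := subsetP ADB i; rewrite !inE.
by case: (i \in D); case: (i \in A); case: (i \in B) => //= ->.
Qed.

(** Adding any further point to a maximal separated family would destroy
separation, so the neighbourhoods of its members cover F. *)
Lemma greedy_packing (X : finType) (F : {set X}) (near : rel X) V :
  reflexive near -> {in F &, symmetric near} ->
  {in F, forall x, (#|[set y in F | near x y]%SET| <= V)%N} ->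
  exists C : {set X}, [/\ C \subset F,
    {in C &, forall x y, x != y -> ~~ near x y} & (#|F| <= #|C| * V)%N].
Proof.
move=> rn sn FV.
pose P (C : {set X}) := (C \subset F) &&
  [forall x in C, forall y in C, (x != y) ==> ~~ near x y].
have P0 : P set0.
  rewrite /P sub0set; apply/forall_inP => x; by rewrite inE.
have [C /maxsetP[/andP[CF sepC] maxC] _] := maxset_exists P0.
have {}sepC : {in C &, forall x y, x != y -> ~~ near x y}.
  by move=> x y xC yC; have /forall_inP/(_ y yC)/implyP := forall_inP sepC x xC.
exists C; split=> //.
have cov : F \subset \bigcup_(x in C) [set y in F | near x y]%SET.
  apply/subsetP => y yF; apply: contraT => /bigcupP ny.
  have yn x : x \in C -> ~~ near x y.
    by move=> xC; apply/negP => xy; apply: ny; exists x => //; rewrite inE yF.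
  suff yC : y \in C by have := yn y yC; rewrite rn.
  rewrite -(maxC (y |: C)%SET) ?setU11 ?subsetU1 //.
  rewrite /P subUset sub1set yF CF /=.
  apply/forall_inP => u; rewrite !inE => uC; apply/forall_inP => v.
  rewrite !inE => vC; apply/implyP => uv.
  move: uC vC uv => /orP[/eqP->|uC] /orP[/eqP->|vC]; first by rewrite eqxx.
  - by rewrite sn ?yn // (subsetP CF).
  - by rewrite yn.
  - exact: sepC.
apply: (leq_trans (subset_leq_card cov)); rewrite -sum_nat_const.
apply: (@leq_trans (\sum_(x in C) #|[set y in F | near x y]%SET|)%N); last first.
  by apply: leq_sum => x xC; rewrite FV // (subsetP CF).
elim/big_rec2: _ => [|x m A _ Am]; first by rewrite cards0.
by rewrite (leq_trans (leq_card_setU _ _)) // leq_add2l.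
Qed.

Lemma card_split_draws (T : finType) (C : {set T}) a b :
  ('C(#|C|, a) * 'C(#|~: C|, b) <=
   #|[set A : {set T} | (#|A :&: C| == a) && (#|A :&: ~: C| == b)]%SET|)%N.
Proof.
rewrite -!cards_draws -cardsX.
have split_union (A B : {set T}) : A \subset C -> B \subset ~: C ->
    (A :|: B) :&: C = A /\ (A :|: B) :&: ~: C = B.
  move=> /subsetP AC /subsetP BC; split; apply/setP => i; rewrite !inE;
    have := introT implyP (AC i); have := introT implyP (BC i); rewrite inE;
    by case: (i \in A); case: (i \in B); case: (i \in C).
rewrite -(@card_in_imset _ _ (fun p : {set T} * {set T} => p.1 :|: p.2)%SET).
  apply/subset_leq_card/subsetP => D /imsetP[[A B]].
  rewrite !inE /= => /andP[/andP[AC cA] /andP[BC cB]] ->.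
  by have [-> ->] := split_union _ _ AC BC; rewrite cA.
move=> [A B] [A' B']; rewrite !inE /= => /andP[/andP[AC _] /andP[BC _]].
move=> /andP[/andP[AC' _] /andP[BC' _]] e.
have [uA uB] := split_union _ _ AC BC.
have [uA' uB'] := split_union _ _ AC' BC'.
by congr pair; [rewrite -uA e uA' | rewrite -uB e uB'].
Qed.

Lemma flip_packing (T : finType) (C0 : {set T}) N a s :
  #|C0| = N -> #|~: C0| = N -> (s <= a.*2)%N ->
  exists C : {set {set T}},
    [/\ {in C, forall A, #|A :&: C0| = a /\ #|A :&: ~: C0| = a},
        {in C &, forall A B, A != B -> (s < #|A :\: B|)%N} &
        ('C(N, a) ^ 2 <= #|C| * ('C(a.*2, s) * 'C(#|T|, s)))%N].
Proof.
move=> c0 c1 sa.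
pose F := [set A : {set T} | (#|A :&: C0| == a) && (#|A :&: ~: C0| == a)]%SET.
have FP A : A \in F -> [/\ #|A :&: C0| = a, #|A :&: ~: C0| = a & #|A| = a.*2].
  rewrite inE => /andP[/eqP A0 /eqP A1]; split=> //.
  by rewrite -(cardsID C0 A) setDE A0 A1 addnn.
have [||A AF|C [CF sepC szC]] :=
    @greedy_packing _ F (fun A B => #|A :\: B| <= s)%N ('C(a.*2, s) * 'C(#|T|, s)).
- by move=> A; rewrite setDv cards0.
- move=> A B /FP[_ _ cA] /FP[_ _ cB]; rewrite !cardsD cA cB.
  by rewrite (setIC A B).
- have [_ _ cA] := FP _ AF; rewrite -[in leqRHS]cA.
  apply: leq_trans (card_near_set _); last by rewrite cA.
  apply/subset_leq_card/subsetP => B; rewrite [_ \in finset _]inE.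
  by case/andP => /FP[_ _ cB] AB; rewrite inE cA cB eqxx.
exists C; split.
- by move=> A /(subsetP CF)/FP[].
- by move=> A B AC BC /(sepC _ _ AC BC); rewrite -ltnNge.
- apply: leq_trans szC; rewrite -mulnn -{1}c0 -c1; exact: card_split_draws.
Qed.

(** * Size of the packing *)

Lemma exprn_le_expR_fact (R : realType) (y : R) k :
  0 <= y -> y ^+ k <= expR y * k`!%:R.
Proof.
move=> y0; rewrite -ler_pdivrMr ?ltr0n ?fact_gt0 //.
case: k => [|k]; first by rewrite expr0 divr1; have := expR_ge1Dx y; lra.
by have := expR_ge1Dxn k y0; lra.
Qed.

(** The value 9/4 makes n > 4 e x >= 9 x, which keeps flipped labellings far from
the relabelling of one another; it follows from e^(1/4) >= 5/4. *)
Lemma expR1_ge (R : realType) : 9 / 4 <= expR 1 :> R.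
Proof.
have -> : 1 = 4%:R * 4^-1 :> R by field.
rewrite expRM_natl; apply: (@le_trans _ _ ((5 / 4) ^+ 4)); first by lra.
by rewrite lerXn2r ?nnegrE ?expR_ge0 //; have := expR_ge1Dx (4^-1 : R); lra.
Qed.

(** This is (2 a)^s <= e^(a - s/2) s!, squared to avoid the half.  From
y^s <= e^y s! at y = a/4 one gets (2 a)^s <= 8^s e^(a/4) s!.  Then 8 <= e^(5/2),
and 5 s / 2 + a / 4 <= a - s / 2 is exactly 4 s <= a.  The proof counts powers of
e^(1/4), for which all exponents are integers. *)
Lemma double_pow_le_expR_fact (R : realType) a s : (4 * s <= a)%N ->
  (a.*2)%:R ^+ (2 * s) * expR 1 ^+ s <= expR 1 ^+ (2 * a) * s`!%:R ^+ 2 :> R.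
Proof.
move=> sa.
have e4 k : expR (k%:R / 4) = expR 4^-1 ^+ k :> R by rewrite -expRM_natl.
have e1 k : expR 1 ^+ k = expR 4^-1 ^+ (4 * k) :> R.
  by rewrite exprM -[expR 4^-1 ^+ 4]expRM_natl; congr (expR _ ^+ _); field.
have g1 : 1 <= expR 4^-1 :> R by have := expR_ge1Dx (4^-1 : R); lra.
have g8 : 8 <= expR 4^-1 ^+ 10 :> R.
  apply: (@le_trans _ _ ((5 / 4) ^+ 10)); first by lra.
  by rewrite lerXn2r ?nnegrE ?expR_ge0 //; have := expR_ge1Dx (4^-1 : R); lra.
have key : (a.*2)%:R ^+ s <= expR 4^-1 ^+ (10 * s + a) * s`!%:R :> R.
  have -> : (a.*2)%:R = 8 * (a%:R / 4) :> R by rewrite -muln2 natrM; field.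
  rewrite exprMn exprD exprM -mulrA ler_pM ?exprn_ge0 ?divr_ge0 //.
    by rewrite lerXn2r ?nnegrE ?exprn_ge0 ?expR_ge0.
  by rewrite -e4; apply: exprn_le_expR_fact; rewrite divr_ge0.
rewrite !e1 mulnC exprM.
apply: (@le_trans _ _ ((expR 4^-1 ^+ (10 * s + a) * s`!%:R) ^+ 2 * expR 4^-1 ^+ (4 * s))).
  by rewrite ler_wpM2r ?exprn_ge0 ?expR_ge0 //
    lerXn2r ?nnegrE ?exprn_ge0 ?mulr_ge0 ?exprn_ge0 ?expR_ge0.
rewrite exprMn mulrAC ler_wpM2r ?exprn_ge0 // -exprM -exprD.
by apply: ler_weXn2l => //; lia.
Qed.

(** With f = s!, the elementary bounds on the binomials give
N^(2a) f^2 <= m a^(2a) (2a)^s (2N)^s; replacing f^2 by (2a)^(2s) e^(s - 2a) and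
cancelling leaves the claim, with no loss in the base N / (e a). *)
Lemma packing_size_ge (R : realType) N a s m :
  (0 < a)%N -> (4 * s <= a)%N -> (a <= N)%N ->
  ('C(N, a) ^ 2 <= m * ('C(a.*2, s) * 'C(N.*2, s)))%N ->
  (N%:R / (expR 1 * a%:R)) ^+ (2 * a - s) <= m%:R :> R.
Proof.
move=> a0 sa aN szm.
have cnt : (N ^ (2 * a) * s`! ^ 2 <= a ^ (2 * a) * m * (a.*2 ^ s * N.*2 ^ s))%N.
  apply: (@leq_trans ((a ^ a * 'C(N, a)) ^ 2 * s`! ^ 2)%N).
    by rewrite (mulnC 2%N) expnM leq_mul2r leq_sqr expn_le_bin ?orbT.
  rewrite (mulnC 2%N) expnM; set u := (a ^ a)%N.
  have -> : ((u * 'C(N, a)) ^ 2 * s`! ^ 2 = u ^ 2 * ('C(N, a) ^ 2 * s`! ^ 2))%N by ring.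
  rewrite -[leqRHS]mulnA leq_mul2l; apply/orP; right.
  apply: (leq_trans (leq_mul szm (leqnn _))).
  rewrite -[leqLHS]mulnA leq_mul2l; apply/orP; right.
  by rewrite -mulnn mulnACA leq_mul ?bin_le_expn.
have N0 : (0 < N)%N := leq_trans a0 aN.
set E : R := expR 1; have E0 : 0 < E := expR_gt0 1.
have cntR : N%:R ^+ (2 * a) * s`!%:R ^+ 2 <=
    a%:R ^+ (2 * a) * m%:R * (a.*2%:R ^+ s * N.*2%:R ^+ s) :> R.
  by rewrite -!natrX -!natrM ler_nat.
have {}sz : N%:R ^+ (2 * a) * (a.*2%:R ^+ (2 * s) * E ^+ s) <=
    E ^+ (2 * a) * (a%:R ^+ (2 * a) * m%:R * (a.*2%:R ^+ s * N.*2%:R ^+ s)) :> R.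
  apply: (@le_trans _ _ (E ^+ (2 * a) * (N%:R ^+ (2 * a) * s`!%:R ^+ 2))).
    rewrite [leRHS]mulrCA ler_wpM2l ?exprn_ge0 //; exact: double_pow_le_expR_fact.
  by rewrite ler_wpM2l ?exprn_ge0 // (ltW E0).
(* With 2 a = s + q, the common factor ((2a) e N a 2)^s cancels. *)
have [q qE] : exists q, (2 * a = s + q)%N by exists (2 * a - s)%N; lia.
rewrite qE addKn exprMn exprVn ler_pdivrMr ?exprn_gt0 ?mulr_gt0 ?ltr0n //.
have D0 : 0 < (a.*2%:R * E * N%:R * a%:R * 2) ^+ s :> R.
  by rewrite exprn_gt0 ?mulr_gt0 ?ltr0n ?double_gt0.
rewrite -(ler_pM2r D0); move: sz; rewrite qE.
by congr (_ <= _); rewrite ?(mulnC 2%N s) ?exprM -!muln2 !natrM !exprMn !exprD; ring.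
Qed.

(** * Coupling of block models that differ at one vertex *)

Definition splice_mx n (i : 'I_n) (G H : graph n) : 'M[bool]_n :=
  \matrix_(u, v) if (u == i) || (v == i) then adj H u v else adj G u v.

Lemma splice_is_graph n (i : 'I_n) (G H : graph n) : is_graph (splice_mx i G H).
Proof.
have /andP[/eqP/matrixP sG /forallP dG] := valP G.
have /andP[/eqP/matrixP sH /forallP dH] := valP H.
apply/andP; split.
  apply/eqP/matrixP => u v; rewrite !mxE orbC.
  by have := sG u v; have := sH u v; rewrite !mxE /adj => -> ->.
by apply/forallP => u; rewrite mxE /adj; case: ifP.
Qed.

Definition splice n (i : 'I_n) (G H : graph n) : graph n :=
  Sub (splice_mx i G H) (splice_is_graph i G H).

Lemma adj_splice n (i : 'I_n) (G H : graph n) u v :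
  adj (splice i G H) u v =
  if (u == i) || (v == i) then adj H u v else adj G u v.
Proof. by rewrite /adj /= mxE. Qed.

Lemma spliceK n (i : 'I_n) (G H : graph n) :
  splice i (splice i G H) (splice i H G) = G.
Proof.
apply/val_inj/matrixP => u v.
rewrite -[LHS]/(adj _ u v) -[RHS]/(adj G u v) !adj_splice.
by case: (_ || _).
Qed.

Lemma d_node_splice n (i : 'I_n) (G H : graph n) :
  (d_node G (splice i G H) <= 1)%N.
Proof.
apply/d_nodeP; exists [set i]%SET; last by rewrite cards1.
apply/forallP => u; apply/forallP => v; apply/implyP.
by rewrite !inE adj_splice -negb_or => /negbTE ->.
Qed.

(** Edges away from i have the same law under th and th', and edges at i change
places together with their law. *)
Lemma sbm_splice (R : realType) n k (B : 'M[R]_k) (th th' : labels n k)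
    (i : 'I_n) (G H : graph n) :
  (forall u, u != i -> th u = th' u) ->
  sbm B th' G * sbm B th H = sbm B th (splice i G H) * sbm B th' (splice i H G).
Proof.
move=> thE; rewrite /sbm -!big_split /=; apply: eq_bigr => u _.
rewrite -!big_split /=; apply: eq_bigr => v _; rewrite !adj_splice.
case: ifP => [_|/norP[ui vi]]; first by rewrite mulrC.
by rewrite (thE _ ui) (thE _ vi).
Qed.

Definition output_prob (R : realType) n k (M : algorithm R n k) (B : 'M[R]_k)
    (th : labels n k) (S : {set labels n k}) : R :=
  \sum_(G : graph n) sbm B th G * Pr (M G) S.

(** Both sides are expectations over a pair (G, H) drawn from th' and th; by
[sbm_splice], the involution turns the law of the spliced graph into that of th.
Privacy is then applied pointwise to G and its splice. *)
Lemma output_prob_vertex (R : realType) n k (M : algorithm R n k) (B : 'M[R]_k)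
    (eps delta : R) (th th' : labels n k) (i : 'I_n) S :
  sbm_matrix B -> node_dp eps delta M ->
  (forall u, u != i -> th u = th' u) ->
  output_prob M B th' S <= expR eps * output_prob M B th S + delta.
Proof.
move=> Bok dp thE.
have sw : involutive (fun p : graph n * graph n => (splice i p.1 p.2, splice i p.2 p.1)).
  by move=> [G H] /=; rewrite !spliceK.
have pairE (f : graph n -> R) (t t' : labels n k) :
    \sum_G sbm B t G * f G = \sum_p sbm B t p.1 * sbm B t' p.2 * f p.1.
  rewrite -(pair_bigA _ (fun G H => sbm B t G * sbm B t' H * f G)) /=.
  apply: eq_bigr => G _; rewrite -mulr_suml -mulr_sumr.
  by rewrite (sbm_sum1 B t') mulr1.
rewrite /output_prob (pairE _ th' th) (pairE _ th th').
rewrite [X in _ <= expR eps * X + _](reindex_inj (inv_inj sw)) /=.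
have -> : delta = \sum_p sbm B th' p.1 * sbm B th p.2 * delta.
  by rewrite -(pairE (fun=> delta)) -mulr_suml sbm_sum1 mul1r.
rewrite mulr_sumr -big_split /=; apply: ler_sum => -[G H] _ /=.
rewrite -(sbm_splice B G H thE) mulrCA -mulrDr.
by rewrite ler_wpM2l ?mulr_ge0 ?sbm_ge0 // dp // d_node_splice.
Qed.

(** The labels are changed one vertex at a time.  The intermediate labellings need
not be balanced, which is why the coupling is stated for arbitrary ones. *)
Lemma output_prob_group (R : realType) n k (M : algorithm R n k) (B : 'M[R]_k)
    (eps delta : R) (th th' : labels n k) S d :
  sbm_matrix B -> 0 <= eps -> 0 <= delta -> node_dp eps delta M ->
  (#|[set i | th i != th' i]%SET| <= d)%N ->
  output_prob M B th' S <=
    expR (d%:R * eps) * (output_prob M B th S + d%:R * delta).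
Proof.
move=> Bok eps0 delta0 dp; elim: d th' => [|d IH] th'.
  rewrite leqn0 cards_eq0 => /eqP D0; rewrite !mul0r expR0 mul1r addr0.
  suff -> : th' = th by [].
  apply/ffunP => i; apply/eqP; apply: contraFT (in_set0 i).
  by rewrite -D0 inE eq_sym.
move=> cD; have [D0|[i iD]] := set_0Vmem [set i | th i != th' i]%SET.
  have := IH th'; rewrite D0 cards0 => /(_ isT)/le_trans; apply.
  have P0 : 0 <= output_prob M B th S.
    apply: sumr_ge0 => G _; rewrite mulr_ge0 ?sbm_ge0 //.
    by apply: sumr_ge0 => x _; exact: Defs.pmf_ge0.
  rewrite ler_pM ?expR_ge0 ?addr_ge0 ?mulr_ge0 ?ler0n //.
    by rewrite ler_expR ler_wpM2r ?ler_nat.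
  by rewrite lerD2l ler_wpM2r ?ler_nat.
pose t := [ffun u => if u == i then th i else th' u] : labels n k.
have tE u : u != i -> t u = th' u by rewrite ffunE => /negbTE ->.
apply: (le_trans (output_prob_vertex S Bok dp tE)).
have ct : (#|[set u | th u != t u]%SET| <= d)%N.
  move: cD; rewrite (cardsD1 i) iD ltnS; apply: leq_trans.
  apply/subset_leq_card/subsetP => u; rewrite !inE ffunE.
  by case: (u =P i) => [->|_]; rewrite ?eqxx.
have := IH _ ct; set P := output_prob _ _ _ _; set Q := output_prob _ _ _ _ => h.
have e1 : 1 <= expR eps by have := expR_ge1Dx eps; lra.
have -> : expR (d.+1%:R * eps) = expR eps * expR (d%:R * eps).
  by rewrite -expRD -natr1; congr expR; ring.
have ed : 1 <= expR (d%:R * eps).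
  by have := expR_ge1Dx (d%:R * eps); have := mulr_ge0 (ler0n R d) eps0; lra.
apply: (@le_trans _ _ (expR eps * (expR (d%:R * eps) * (Q + d%:R * delta)) + delta)).
  by rewrite lerD2r ler_wpM2l ?expR_ge0.
have := mulr_ege1 e1 ed; rewrite -natr1; nra.
Qed.

(** * Privacy limits the size of a packing *)

Lemma Pr_sum_le1 (R : realType) (T I : finType) (d : fdist R T) (C : {set I})
    (S : I -> {set T}) :
  {in C &, forall c c', c != c' -> [disjoint S c & S c']} ->
  \sum_(c in C) Pr d (S c) <= 1.
Proof.
move=> dS; rewrite -(pmf_sum1 d) /Pr (exchange_big_dep predT) //=.
apply: ler_sum => x _.
have [c /andP[cC xc]|none] := pickP (fun c => (c \in C) && (x \in S c)).
  rewrite (bigD1 c) /= ?cC // big1 ?addr0 // => c' /andP[/andP[c'C xc'] cc'].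
  by have := disjointFr (dS _ _ c'C cC cc') xc'; rewrite xc.
by rewrite big_pred0 // Defs.pmf_ge0.
Qed.

(** Under the model of th c0 the disjoint events S c have total mass at most 1, and
S c0 takes 1 - eta of it; each of the others has at least the mass that group
privacy transports from its own model. *)
Lemma packing_privacy (R : realType) n k (M : algorithm R n k) (B : 'M[R]_k)
    (eps delta eta : R) (I : finType) (C : {set I})
    (th : I -> labels n k) (S : I -> {set labels n k}) (c0 : I) d :
  sbm_matrix B -> 0 <= eps -> 0 <= delta -> node_dp eps delta M ->
  c0 \notin C ->
  {in c0 |: C &, forall c c', c != c' -> [disjoint S c & S c']} ->
  {in c0 |: C, forall c, 1 - eta <= output_prob M B (th c) (S c)} ->
  {in C, forall c, (#|[set i | th c0 i != th c i]%SET| <= d)%N} ->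
  #|C|%:R * (1 - eta - d%:R * delta * expR (d%:R * eps)) <= eta * expR (d%:R * eps).
Proof.
move=> Bok eps0 delta0 dp c0C dS rec near.
have tot : \sum_(c in c0 |: C) output_prob M B (th c0) (S c) <= 1.
  rewrite /output_prob exchange_big /= -(sbm_sum1 B (th c0)).
  apply: ler_sum => G _; rewrite -mulr_sumr -[leRHS]mulr1.
  by rewrite ler_wpM2l ?sbm_ge0 // Pr_sum_le1.
set E := expR (d%:R * eps); have E0 : 0 < E := expR_gt0 _.
have low : {in C, forall c,
    (1 - eta - d%:R * delta * E) / E <= output_prob M B (th c0) (S c)}.
  move=> c cC; rewrite ler_pdivrMr //.
  have := output_prob_group (S c) Bok eps0 delta0 dp (near c cC).
  have := rec c (setU1r _ cC); rewrite -/E; lra.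
move: tot; rewrite big_setU1 //= => tot.
have : \sum_(c in C) (1 - eta - d%:R * delta * E) / E <=
    \sum_(c in C) output_prob M B (th c0) (S c) by exact: ler_sum.
rewrite sumr_const -[leLHS]mulr_natl mulrA => sumlow.
have := rec c0 (setU11 _ _) => r0.
have : #|C|%:R * (1 - eta - d%:R * delta * E) / E <= eta by lra.
by rewrite ler_pdivrMr.
Qed.

(** * Loss and flipped labellings *)

Lemma misrateE (R : realType) n k (est th : labels n k) (s : 'S_k) :
  misrate R est th s = 2 / n%:R * #|[set i | s (est i) != th i]%SET|%:R.
Proof.
rewrite /misrate; congr (_ * _).
rewrite -sum1dep_card natr_sum [RHS]big_mkcond /=.
by apply: eq_bigr => i _; case: (_ != _).
Qed.

Lemma rev_ord2_eq (c d : 'I_2) : (rev_ord c == d) = (c != d).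
Proof. by case: c d => [[|[|?]] ?] [[|[|?]] ?]. Qed.

Lemma perm2_id_or_rev (t : 'S_2) : t =1 id \/ t =1 @rev_ord 2.
Proof.
have t01 : t ord0 != t ord_max by rewrite (inj_eq perm_inj).
have [t0|t0] := eqVneq (t ord0) ord0; [left|right] => c.
  have t1 : t ord_max = ord_max.
    by apply/eqP; move: t01; rewrite t0; case: (t _) => [[|[|?]] ?].
  have [->|c1] := eqVneq c ord0; first by [].
  by have -> : c = ord_max by apply/eqP; move: c1; case: c => [[|[|?]] ?].
have t0' : t ord0 = ord_max.
  by apply/eqP; move: t0; case: (t _) => [[|[|?]] ?].
have t1 : t ord_max = ord0.
  by apply/eqP; move: t01; rewrite t0'; case: (t _) => [[|[|?]] ?].
have [->|c1] := eqVneq c ord0; first by rewrite t0'; apply/val_inj.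
have -> : c = ord_max by apply/eqP; move: c1; case: c => [[|[|?]] ?].
by rewrite t1; apply/val_inj.
Qed.

(** An estimate accurate for both labellings, through the permutations s and s',
misses at most x = xi n nodes in total.  Outside these nodes th' is s^-1 s' applied
to th, and on two labels this permutation is the identity or the exchange, so
there th and th' agree everywhere or differ everywhere. *)
Lemma loss_balls_disjoint (R : realType) n (th th' : labels n 2) (xi : R) :
  (0 < n)%N ->
  xi * n%:R < #|[set i | th i != th' i]%SET|%:R ->
  xi * n%:R < #|[set i | th i == th' i]%SET|%:R ->
  [disjoint [set est | loss R est th <= xi]%SET
          & [set est | loss R est th' <= xi]%SET].
Proof.
move=> n0 far farC; rewrite -setI_eq0; apply/eqP/setP => est; rewrite !inE.
apply/negP => /andP[/lossP[s es] /lossP[s' es']].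
move: es es'; rewrite !misrateE.
set W := [set i | s (est i) != th i]%SET; set W' := [set i | s' (est i) != th' i]%SET.
move=> es es'; have WW : #|W :|: W'|%:R <= xi * n%:R.
  apply: (@le_trans _ _ (#|W|%:R + #|W'|%:R)).
    by rewrite -natrD ler_nat leq_card_setU.
  have n0R : 0 < n%:R :> R by rewrite ltr0n.
  move: es es'; rewrite ![2 / _ * _]mulrAC !ler_pdivrMr //; lra.
have out i : i \notin W :|: W' -> th' i = (s^-1 * s')%g (th i).
  by rewrite !inE negb_or !negbK => /andP[/eqP <- /eqP <-]; rewrite permM permK.
have sub (D : {set 'I_n}) : xi * n%:R < #|D|%:R -> ~ (D \subset W :|: W').
  move=> lt /subset_leq_card; rewrite -(ler_nat R) => h; lra.
have [tid|trev] := perm2_id_or_rev (s^-1 * s')%g.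
  apply: (sub _ far); apply/subsetP => i; rewrite inE; apply: contraR => /out ->.
  by rewrite tid.
apply: (sub _ farC); apply/subsetP => i; rewrite inE.
apply: contraLR => /out ->.
by rewrite trev eq_sym rev_ord2_eq eqxx.
Qed.

Definition flip n (th : labels n 2) (A : {set 'I_n}) : labels n 2 :=
  [ffun i => if i \in A then rev_ord (th i) else th i].

Lemma flip_neq n (th : labels n 2) (A A' : {set 'I_n}) i :
  (flip th A i != flip th A' i) = (i \in A) (+) (i \in A').
Proof.
rewrite !ffunE; case: (i \in A); case: (i \in A') => /=; rewrite ?eqxx //.
  by rewrite rev_ord2_eq eqxx.
by rewrite eq_sym rev_ord2_eq eqxx.
Qed.

Lemma flip_balanced n (th : labels n 2) (A : {set 'I_n}) :
  let D := [set i | th i == ord0]%SET in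
  balanced th -> #|A :&: D| = #|A :&: ~: D| -> balanced (flip th A).
Proof.
move=> D bal AD j.
have -> : #|[set i | flip th A i == j]%SET| = #|[set i | th i == j]%SET|.
  have flipj c i : (flip th A i == c) = (i \in A) (+) (th i == c).
    by rewrite ffunE; case: (i \in A); rewrite ?rev_ord2_eq.
  rewrite -(cardsID A) -[RHS](cardsID A); congr addn; last first.
    by apply: eq_card => i; rewrite !inE flipj; case: (i \in A).
  have D0 : #|[set i | th i == ord0]%SET :&: A| = #|A :&: D| by rewrite setIC.
  have D1 : #|[set i | th i != ord0]%SET :&: A| = #|A :&: ~: D|.
    by rewrite setIC; congr #|pred_of_set (_ :&: _)|; apply/setP => i; rewrite !inE.
  have [->|j1] := eqVneq j ord0.
    rewrite D0 AD -D1; apply: eq_card => i; rewrite !inE flipj.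
    by case: (i \in A); case: (th i == ord0).
  have thj i : (th i == j) = (th i != ord0).
    by move: j1; case: (th i) => [[|[|?]] ?]; case: j {flipj} => [[|[|?]] ?].
  transitivity #|A :&: D|.
    rewrite -D0; apply: eq_card => i; rewrite !inE flipj thj.
    by case: (i \in A); case: (th i == ord0).
  by rewrite AD -D1; apply: eq_card => i; rewrite !inE thj.
exact: bal.
Qed.

Lemma balanced_exists n : ~~ odd n -> exists th : labels n 2, balanced th.
Proof.
move=> ev; have nE : (n = n./2.*2)%N by rewrite -[LHS]odd_double_half (negbTE ev).
have [||D [_ _ cD]] := @set_between 'I_n set0 setT n./2.
- exact: sub0set.
- by rewrite cards0 cardsT card_ord; lia.
exists [ffun i => if i \in D then ord0 else ord_max] => j.
have cDC : #|~: D| = n./2 by rewrite cardsCs setCK cD card_ord; lia.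
have -> : #|[set i | [ffun i => if i \in D then ord0 else ord_max] i == j]%SET| = n./2.
  have [->|j1] := eqVneq j ord0.
    by rewrite -cD; apply: eq_card => i; rewrite inE ffunE; case: (i \in D).
  rewrite -cDC; apply: eq_card => i; rewrite !inE ffunE.
  by move: j1; case: j => [[|[|?]] ?]; case: (i \in D).
lia.
Qed.

(** The empty set stands for the unflipped labelling, the centre of the packing.
Distances are even, hence at least 2 s + 2 rather than 2 s + 1, and this is what
exceeds x when s is the integer part of x / 2. *)
Lemma flip_code n N a s : n = N.*2 -> (s < a)%N ->
  exists (th : labels n 2) (C : {set {set 'I_n}}),
    [/\ set0 \notin C,
        {in set0 |: C, forall A, balanced (flip th A)},
        {in C, forall A : {set 'I_n}, #|A| = a.*2},
        {in set0 |: C &, forall A A' : {set 'I_n}, A != A' ->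
          (s.+1.*2 <= #|[set i | flip th A i != flip th A' i]%SET| <= 4 * a)%N} &
        ('C(N, a) ^ 2 <= #|C| * ('C(a.*2, s) * 'C(N.*2, s)))%N].
Proof.
move=> nE sa; have ev : ~~ odd n by rewrite nE odd_double.
have [th bal] := balanced_exists ev.
pose D := [set i | th i == ord0]%SET.
have cD : #|D| = N by have := bal ord0; rewrite -/D; clear -nE; lia.
have cDC : #|~: D| = N by rewrite cardsCs setCK cD card_ord; clear -nE; lia.
have [|C [CP sepC szC]] := @flip_packing _ D N a s cD cDC.
  by clear - sa; lia.
rewrite card_ord [in 'C(n, _)]nE in szC.
have cardC : {in C, forall A : {set 'I_n}, #|A| = a.*2}.
  by move=> A /CP[A0 A1]; rewrite -(cardsID D A) setDE A0 A1 addnn.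
exists th, C; split=> //.
- by apply/negP => /cardC; rewrite cards0; clear - sa; lia.
- move=> A; rewrite !inE => /orP[/eqP->|AC]; apply: flip_balanced => //.
    by rewrite !set0I.
  by have [-> ->] := CP A AC.
move=> A A' AC AC' AA'.
have -> : #|[set i | flip th A i != flip th A' i]%SET| =
    (#|A :\: A'| + #|A' :\: A|)%N.
  rewrite -cardsUI [in X in (_ + X)%N](_ : _ :&: _ = set0) ?cards0 ?addn0.
    apply: eq_card => i; rewrite inE flip_neq !inE.
    by case: (i \in A); case: (i \in A').
  by apply/setP => i; rewrite !inE; case: (i \in A); case: (i \in A').
move: AC AC'; rewrite !inE => /orP[/eqP A0|AC] /orP[/eqP A'0|A'C].
- by rewrite A0 A'0 eqxx in AA'.
- by rewrite A0 set0D setD0 cards0 cardC //; clear - sa; lia.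
- by rewrite A'0 set0D setD0 cards0 cardC //; clear - sa; lia.
rewrite -addnn leq_add ?sepC //=; last by rewrite eq_sym.
have -> : (4 * a = #|A| + #|A'|)%N by rewrite !cardC //; clear; lia.
by rewrite leq_add // subset_leq_card // subsetDl.
Qed.

(** * The lower bound on eps *)

(** The number a of flips in each class lies between x and 2 x.  The upper bound
keeps the packing at distance 2 a <= 4 x from its centre and makes any two of its
labellings agree in at least n - 8 x > x nodes, so that exchanging the labels does
not bring them close; the lower bound gives the exponent. *)
Lemma dp_recovery_packing (R : realType) n (B : 'M[R]_2) (eps delta xi eta : R) :
  (0 < n)%N -> ~~ odd n -> sbm_matrix B ->
  0 <= eps -> 0 <= delta -> 0 <= eta -> n%:R^-1 <= xi ->
  4 * expR 1 * xi < 1 -> dp_recovery n B eps delta xi eta ->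
  exists2 m : nat, (4 * expR 1 * xi) `^ (- (xi * n%:R)) <= m%:R &
    m%:R * (1 - eta - 4 * delta * xi * n%:R * expR (4 * eps * xi * n%:R))
      <= eta * expR (4 * eps * xi * n%:R).
Proof.
move=> n0 ev Bok eps0 delta0 eta0 xin small [M [dp rec]].
have n0R : 0 < n%:R :> R by rewrite ltr0n.
have x1 : 1 <= xi * n%:R by rewrite -ler_pdivrMr // mul1r.
have xi0 : 0 < xi by apply: lt_le_trans xin; rewrite invr_gt0.
have e94 := expR1_ge R.
have e0 : 0 < expR 1 :> R := expR_gt0 1.
have -> : 4 * delta * xi * n%:R = 4 * (xi * n%:R) * delta by ring.
have -> : 4 * eps * xi * n%:R = 4 * (xi * n%:R) * eps by ring.
have xiE : xi = xi * n%:R / n%:R by rewrite mulfK ?gt_eqF.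
move: xiE small rec x1; set x := xi * n%:R => xiE small rec x1.
have xn : 4 * expR 1 * x < n%:R by rewrite /x mulrA -[ltRHS]mul1r ltr_pM2r.
have x9n : 9 * x < n%:R by apply: le_lt_trans xn; rewrite ler_pM2r; lra.
pose N := n./2; pose a := Num.trunc (2 * x); pose s := Num.trunc (x / 2).
have nE : n = N.*2 by rewrite -[LHS]odd_double_half (negbTE ev).
have nER : n%:R = 2 * N%:R :> R by rewrite [in LHS]nE -muln2 natrM mulrC.
have /andP[a_le a_gt] : a%:R <= 2 * x < a.+1%:R by apply: truncn_itv; lra.
have /andP[s_le s_gt] : s%:R <= x / 2 < s.+1%:R by apply: truncn_itv; lra.
rewrite -natr1 in a_gt; have s_gt' := s_gt; rewrite -natr1 in s_gt'.
have xa : x <= a%:R.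
  have [x2|x2] := leP 2 x; first lra.
  have a2 : (2 <= a)%N.
    by rewrite -ltnS -(ltr_nat R) -natr1; apply: le_lt_trans a_gt; lra.
  by apply: (le_trans (ltW x2)); rewrite (ler_nat R 2).
have sa : (4 * s <= a)%N by rewrite -ltnS -(ltr_nat R) -natr1 natrM; lra.
have aN : (a <= N)%N by rewrite -(ler_nat R); lra.
have a0 : (0 < a)%N by rewrite -(ltr_nat R); lra.
have [|th [C [s0C bal cardC far szC]]] := @flip_code n N a s nE.
  by clear - a0 sa; lia.
exists #|C|.
  apply: le_trans (packing_size_ge R a0 sa aN szC).
  (* The exponent 2 a - s is at least a >= x, and the base N / (e a) is at least
     (4 e xi)^-1 = N / (2 e x) because a <= 2 x. *)
  have r1 : 1 <= (4 * expR 1 * xi)^-1 by rewrite invf_ge1 ?ltW // !mulr_gt0.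
  have -> : (4 * expR 1 * xi) `^ (- x) = (4 * expR 1 * xi)^-1 `^ x.
    rewrite -[(4 * expR 1 * xi)^-1]powR_inv1 ?mulr_ge0 ?ltW //.
    by rewrite -powRrM mulN1r.
  have xs : x <= (2 * a - s)%:R.
    by apply: (le_trans xa); rewrite ler_nat; clear -sa; lia.
  apply: (le_trans (ler_powR r1 xs)).
  rewrite powR_mulrn ?(le_trans ler01) //.
  have N0 : 0 <= N%:R / (expR 1 * a%:R) :> R.
    by rewrite divr_ge0 ?mulr_ge0 ?expR_ge0 ?ler0n.
  rewrite lerXn2r ?nnegrE ?(le_trans ler01 r1) //.
  rewrite ler_pdivlMr ?mulr_gt0 ?ltr0n // ler_pdivrMl ?mulr_gt0 //.
  have -> : 4 * expR 1 * xi * N%:R = expR 1 * (2 * x) by rewrite /x nER; ring.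
  by rewrite ler_pM2l.
pose S A := [set est | loss R est (flip th A) <= xi]%SET.
have disj : {in set0 |: C &, forall A A', A != A' -> [disjoint S A & S A']}.
  move=> A A' AC AC' /(far A A' AC AC') /andP[lo hi].
  apply: loss_balls_disjoint => //; rewrite -/x.
    apply: (lt_le_trans (_ : x < s.+1.*2%:R)); last by rewrite ler_nat.
    by rewrite -muln2 natrM; lra.
  set h := #|[set i | flip th A i != flip th A' i]%SET| in lo hi *.
  have -> : #|[set i | flip th A i == flip th A' i]%SET| = (n - h)%N.
    rewrite cardsCs card_ord; congr (n - _)%N.
    by apply: eq_card => i; rewrite !inE.
  have hn : (h <= n)%N by rewrite -[leqRHS]card_ord max_card.
  rewrite natrB //.
  have : h%:R <= 4 * a%:R :> R by rewrite -natrM ler_nat.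
  lra.
have priv := @packing_privacy _ _ _ M B eps delta eta _ C
  (flip th) S set0 a.*2 Bok eps0 delta0 dp s0C disj.
have {priv} : #|C|%:R * (1 - eta - a.*2%:R * delta * expR (a.*2%:R * eps))
    <= eta * expR (a.*2%:R * eps).
  apply: priv => [A AC|A AC]; first exact/rec/bal.
  rewrite -(cardC A AC); apply/subset_leq_card/subsetP => i.
  by rewrite inE flip_neq inE.
have d4 : a.*2%:R <= 4 * x by rewrite -muln2 natrM; lra.
have E4 : expR (a.*2%:R * eps) <= expR (4 * x * eps).
  by rewrite ler_expR ler_wpM2r.
move=> priv; apply: (@le_trans _ _ (eta * expR (a.*2%:R * eps))); last first.
  by rewrite ler_wpM2l.
apply: le_trans priv; rewrite ler_wpM2l // lerD2l lerN2.
by rewrite ler_pM ?mulr_ge0 ?expR_ge0 // ler_wpM2r.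
Qed.

Lemma dp_recovery_eps_ge (R : realType) n (B : 'M[R]_2) (eps delta xi eta : R) :
  (0 < n)%N -> ~~ odd n -> sbm_matrix B ->
  0 <= eps -> 0 <= delta -> 0 < eta ->
  n%:R^-1 <= xi ->
  0 <= 1 - eta - 4 * delta * xi * n%:R * expR (4 * eps * xi * n%:R) \/
  0 <= (4 * expR 1 * xi) `^ (- (xi * n%:R)) / 2 - 1 ->
  dp_recovery n B eps delta xi eta ->
  ln (Num.max 1
        ((1 - eta - 4 * delta * xi * n%:R * expR (4 * eps * xi * n%:R)) *
         ((4 * expR 1 * xi) `^ (- (xi * n%:R)) / 2 - 1) / eta))
    / (4 * xi * n%:R) <= eps.
Proof.
move=> n0 ev Bok eps0 delta0 eta0 xin sgn rec.
have n0R : 0 < n%:R :> R by rewrite ltr0n.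
have xi0 : 0 < xi by apply: lt_le_trans xin; rewrite invr_gt0.
have x0 : 0 < 4 * xi * n%:R by rewrite !mulr_gt0.
have small_or : 4 * expR 1 * xi < 1 \/ (4 * expR 1 * xi) `^ (- (xi * n%:R)) <= 1.
  have [?|c1] := ltP (4 * expR 1 * xi) 1; [by left|right].
  rewrite -[leRHS](powRr0 (4 * expR 1 * xi)) ler_powR // oppr_le0.
  by rewrite mulr_ge0 ?ltW.
move: sgn small_or.
set q := _ `^ _; set A := 1 - eta - _ => sgn small_or.
(* If the maximum is 1 the bound is eps >= 0.  Otherwise the product of the two
   factors is positive, and one of them being nonnegative, both are positive. *)
have [le1|gt1] := leP (A * (q / 2 - 1) / eta) 1.
  by rewrite ln1 mul0r.
have AB : 0 < A * (q / 2 - 1).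
  by move: gt1; rewrite ltr_pdivlMr //; lra.
have [A0 q0] : 0 < A /\ 0 < q / 2 - 1.
  case: sgn => s0.
    have A0 : 0 < A.
      by rewrite lt_def s0 andbT; apply: contraTneq AB => ->; rewrite mul0r ltxx.
    by split=> //; rewrite -(pmulr_rgt0 _ A0).
  have q0 : 0 < q / 2 - 1.
    by rewrite lt_def s0 andbT; apply: contraTneq AB => ->; rewrite mulr0 ltxx.
  by split=> //; rewrite -(pmulr_lgt0 _ q0).
case: small_or => [small|]; last by lra.
have [m qm mA] := dp_recovery_packing n0 ev Bok eps0 delta0 (ltW eta0) xin small rec.
rewrite ler_pdivrMr //.
have -> : eps * (4 * xi * n%:R) = 4 * eps * xi * n%:R by ring.
rewrite -[leRHS]expRK ler_ln ?posrE ?expR_gt0 //; last by lra.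
rewrite ler_pdivrMr // [leRHS]mulrC; apply: le_trans mA; rewrite -/A mulrC.
by rewrite ler_wpM2r ?(ltW A0) //; move: qm; rewrite -/q; lra.
Qed.

Lemma dp_recovery_mono (R : realType) n (B : 'M[R]_2) (eps delta xi eta eta' : R) :
  eta <= eta' -> dp_recovery n B eps delta xi eta ->
  dp_recovery n B eps delta xi eta'.
Proof.
move=> le [M [dp rec]]; exists M; split=> // th bal.
by apply: le_trans (rec th bal); lra.
Qed.

(** The conditions that hold for large n are stated as lower bounds on ln n.  The
error level K / ln n replaces eta, which need not be positive. *)
Lemma dp_recovery_eps_ge_log (R : realType) n (B : 'M[R]_2)
    (eps delta xi eta c0 alpha C K : R) :
  ~~ odd n -> sbm_matrix B -> 0 <= eps -> 0 <= delta -> n%:R^-1 <= xi ->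
  dp_recovery n B eps delta xi eta ->
  0 < c0 -> xi <= c0 / n%:R ->
  0 < alpha -> 0 < C -> delta <= C * n%:R `^ (- alpha) ->
  0 < K -> eta <= K / ln n%:R ->
  1 <= ln n%:R :> R -> 4 * K <= ln n%:R ->
  ln (16 * expR 1 * c0) <= ln n%:R ->
  2 * ln (32 * expR 1 * c0 * K) <= ln n%:R ->
  2 / alpha * ln (16 * c0 * C) <= ln n%:R ->
  Num.min 1 alpha / (8 * c0) * ln n%:R <= eps.
Proof.
move=> ev Bok eps0 delta0 xin rec c00 xic al0 C0 deltaC K0 etaK.
set L := ln n%:R => L1 LK Lc LcK LC.
have n0 : (0 < n)%N.
  by rewrite lt0n; apply/eqP => nz; move: L1; rewrite /L nz ln0 //; lra.
have n0R : 0 < n%:R :> R by rewrite ltr0n.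
have nE : n%:R = expR L :> R by rewrite lnK // posrE.
have xi0 : 0 < xi by apply: lt_le_trans xin; rewrite invr_gt0.
have x1 : 1 <= xi * n%:R by rewrite -ler_pdivrMr // mul1r.
have xc : xi * n%:R <= c0 by rewrite -ler_pdivlMr.
have e0 : 0 < expR 1 :> R := expR_gt0 1.
have L0 : 0 < L by lra.
suff: Num.min 1 alpha * L <= 8 * c0 * eps.
  by move=> h; rewrite mulrAC ler_pdivrMr ?mulr_gt0 // mulrC [eps * _]mulrC mulrC.
(* The threshold leaves 4 delta x exp (4 eps x) <= 1/4 in the second case; together
   with K / ln n <= 1/4 the first factor is then at least 1/2. *)
have [big|small] := leP 1 (16 * c0 * delta * expR (4 * c0 * eps)).
  have : 0 <= ln (16 * c0 * C) - alpha * L + 4 * c0 * eps.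
    rewrite -ler_expR expR0 !expRD lnK ?posrE ?mulr_gt0 //.
    apply: (le_trans big); rewrite ler_wpM2r ?expR_ge0 //.
    rewrite -[leRHS]mulrA ler_wpM2l ?mulr_ge0 ?(ltW c00) //.
    by move: deltaC; rewrite /powR gt_eqF // -/L mulNr.
  have : 2 * ln (16 * c0 * C) <= alpha * L.
    have -> : 2 * ln (16 * c0 * C) = alpha * (2 / alpha * ln (16 * c0 * C)).
      by field; rewrite gt_eqF.
    by rewrite ler_pM2l.
  have : Num.min 1 alpha * L <= alpha * L.
    by rewrite ler_wpM2r ?(ltW L0) // ge_min lexx orbT.
  lra.
have minL : Num.min 1 alpha * L <= L.
  by rewrite -[leRHS]mul1r ler_wpM2r ?(ltW L0) // ge_min lexx.
apply: (le_trans minL).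
have etaKL0 : 0 < K / L by rewrite divr_gt0.
have etaKL : K / L <= 1 / 4 by rewrite ler_pdivrMr //; lra.
have n16 : 16 * expR 1 * c0 <= n%:R.
  by rewrite -ler_ln ?posrE // !mulr_gt0.
pose A := 1 - K / L - 4 * delta * xi * n%:R * expR (4 * eps * xi * n%:R).
have A2 : 1 / 2 <= A.
  have : 4 * delta * xi * n%:R * expR (4 * eps * xi * n%:R) <= 1 / 4.
    apply: (@le_trans _ _ (4 * delta * c0 * expR (4 * c0 * eps))); last by lra.
    have -> : 4 * delta * xi * n%:R = 4 * delta * (xi * n%:R) by ring.
    have -> : 4 * eps * xi * n%:R = 4 * (xi * n%:R) * eps by ring.
    have x0 : 0 <= xi * n%:R by lra.
    apply: ler_pM; rewrite ?expR_ge0 ?mulr_ge0 ?(ltW xi0) //.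
      by rewrite ler_wpM2l ?mulr_ge0.
    by rewrite ler_expR ler_wpM2r // ler_wpM2l.
  rewrite /A; lra.
have base : 4 * expR 1 * xi <= 4 * expR 1 * c0 / n%:R.
  by rewrite -[leRHS]mulrA ler_wpM2l // mulr_ge0 // ltW.
pose q := (4 * expR 1 * xi) `^ (- (xi * n%:R)).
have qn : n%:R / (4 * expR 1 * c0) <= q.
  rewrite /q powRN -[leLHS]invf_div lef_pV2 ?posrE ?powR_gt0 ?divr_gt0 ?mulr_gt0 //.
  apply: (le_trans _ base); apply: ge1r_powR => //.
  rewrite !mulr_gt0 //=; apply: (le_trans base).
  by rewrite ler_pdivrMr // mul1r; apply: le_trans n16; rewrite !ler_wpM2r ?ltW //; lra.
have ec0 : 0 < 4 * expR 1 * c0 by rewrite !mulr_gt0.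
have qB : n%:R / (16 * expR 1 * c0) <= q / 2 - 1.
  have : 4 <= n%:R / (4 * expR 1 * c0) by rewrite ler_pdivlMr //; lra.
  have -> : 16 * expR 1 * c0 = 4 * (4 * expR 1 * c0) by ring.
  by rewrite invfM mulrCA; lra.
have := dp_recovery_eps_ge n0 ev Bok eps0 delta0 etaKL0 xin _ (dp_recovery_mono etaK rec).
rewrite -/A -/q => /(_ (or_introl _)) main.
have {main} : ln (Num.max 1 (A * (q / 2 - 1) / (K / L))) <= eps * (4 * xi * n%:R).
  by rewrite -ler_pdivrMr ?mulr_gt0 //; apply: main; lra.
have prod : n%:R / (32 * expR 1 * c0 * K) <= A * (q / 2 - 1) / (K / L).
  apply: (@le_trans _ _ (1 / 2 * (n%:R / (16 * expR 1 * c0)) / (K / L))).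
    have -> : 1 / 2 * (n%:R / (16 * expR 1 * c0)) / (K / L) =
      n%:R / (32 * expR 1 * c0 * K) * L by field; rewrite !gt_eqF.
    by rewrite ler_peMr // ltW // divr_gt0 // !mulr_gt0.
  rewrite ler_pM2r ?invr_gt0 // ler_pM //.
  by rewrite ltW // divr_gt0 // !mulr_gt0.
have lnm : L - ln (32 * expR 1 * c0 * K) <= ln (Num.max 1 (A * (q / 2 - 1) / (K / L))).
  rewrite /L -ln_div ?posrE ?mulr_gt0 // ler_ln ?posrE ?divr_gt0 ?mulr_gt0 //.
    by rewrite le_max prod orbT.
  by rewrite lt_max ltr01.
move=> main.
have : eps * (4 * xi * n%:R) <= 4 * c0 * eps.
  by rewrite mulrC -mulrA ler_wpM2r // ler_wpM2l.
lra.
Qed.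

Lemma near_ln_ge (R : realType) (m : R) :
  \forall n \near even_oo, m <= ln n%:R.
Proof.
apply: cvg_within; exists (Num.trunc (expR m)).+1 => // n /= h.
rewrite -ler_expR lnK; last by rewrite posrE ltr0n (leq_trans _ h).
have /andP[_ /ltW e] := truncn_itv (expR_ge0 m).
by apply: (le_trans e); rewrite ler_nat.
Qed.

Theorem proposition2 (R : realType) :
  (forall (n : nat) (B : 'M[R]_2) (eps delta xi eta : R),
     (0 < n)%N -> ~~ odd n -> sbm_matrix B ->
     0 <= eps -> 0 <= delta -> 0 < eta ->
     n%:R^-1 <= xi ->
     0 <= 1 - eta - 4 * delta * xi * n%:R * expR (4 * eps * xi * n%:R) \/
     0 <= (4 * expR 1 * xi) `^ (- (xi * n%:R)) / 2 - 1 ->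
     dp_recovery n B eps delta xi eta ->
     ln (Num.max 1
           ((1 - eta - 4 * delta * xi * n%:R * expR (4 * eps * xi * n%:R)) *
            ((4 * expR 1 * xi) `^ (- (xi * n%:R)) / 2 - 1) / eta))
       / (4 * xi * n%:R) <= eps)
  /\
  (forall (B : nat -> 'M[R]_2) (eps delta xi eta p : nat -> R) (c0 c1 : R),
     0 < c0 -> 0 < c1 ->
     (\forall n \near even_oo,
        [/\ sbm_matrix (B n), 0 <= eps n, 0 <= delta n & n%:R^-1 <= xi n]) ->
     (\forall n \near even_oo,
        dp_recovery n (B n) (eps n) (delta n) (xi n) (eta n)) ->
     eta =O_even_oo (fun n => (ln n%:R)^-1) ->
     (\forall n \near even_oo, xi n <= c0 / n%:R) ->
     is_poly_order p -> asymp_eq delta (fun n => (p n)^-1) ->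
     (\forall n \near even_oo, delta n * expR (4 * c0 * eps n) < c1) ->
     asymp_ge eps (fun n => ln n%:R)).
Proof.
split=> [n B eps delta xi eta|]; first exact: dp_recovery_eps_ge.
move=> B eps delta xi eta p c0 c1 c00 _ Hok Hrec Heta Hxi [alpha al0 [[cp cp0 Hp] _]].
move=> [_ [cd cd0 Hd]] _.
have [K K0 HK] : exists2 K : R, 0 < K &
    \forall n \near even_oo, `|eta n| <= K * `|(ln n%:R)^-1|.
  by move/eqO_exP: Heta.
exists (Num.min 1 alpha / (8 * c0)).
  by rewrite divr_gt0 ?mulr_gt0 // lt_min ltr01.
have ev : \forall n \near even_oo, ~~ odd n by exact: withinT.
near=> n.
have [Bok eps0 delta0 xin] : [/\ sbm_matrix (B n), 0 <= eps n, 0 <= delta n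
  & n%:R^-1 <= xi n] by near: n.
have L1 : 1 <= ln n%:R :> R by near: n; exact: near_ln_ge.
have L0 : 0 < ln n%:R :> R by apply: lt_le_trans L1.
have n0 : 0 < n%:R :> R.
  by rewrite ltr0n lt0n; apply/eqP => nz; move: L0; rewrite nz ln0 ?ltxx.
apply: (@dp_recovery_eps_ge_log R n (B n) _ (delta n) (xi n) (eta n) c0 alpha
  (cd * cp)^-1 K) => //; try (near: n; exact: near_ln_ge).
- by near: n.
- by near: n.
- by near: n.
- by rewrite invr_gt0 mulr_gt0.
- have hp : cp * n%:R `^ alpha <= p n by near: n.
  have hd : cd * delta n <= (p n)^-1 by near: n.
  rewrite powRN -invfM -mulrA invfM ler_pdivlMl //; apply: (le_trans hd).
  have P0 : 0 < cp * n%:R `^ alpha by rewrite mulr_gt0 ?powR_gt0.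
  by rewrite lef_pV2 ?posrE // (lt_le_trans P0).
- have : `|eta n| <= K * `|(ln n%:R)^-1| by near: n.
  rewrite (@ger0_norm _ (ln n%:R)^-1) ?invr_ge0 ?(ltW L0) //.
  by apply: le_trans; exact: ler_norm.
Unshelve. all: by end_near. Qed.
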